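(* Let $n\ge 1$, $\eta>0$, and let $t\mapsto C(t)$ be a set-valued map assigning to each $t\in\mathbb{R}$ a nonempty closed $\eta$-prox-regular set $C(t)\subset\mathbb{R}^n$, which is Lipschitz continuous with constant $L_C\ge 0$, i.e. $d_H(C(t_1),C(t_2))\le L_C|t_1-t_2|$ for all $t_1,t_2\in\mathbb{R}$. Let $f:\mathbb{R}\times\mathbb{R}^n\to\mathbb{R}^n$ satisfy, for some $L_f>0$, $$\|f(t_1,x_1)-f(t_2,x_2)\|\le L_f|t_1-t_2|+L_f\|x_1-x_2\|\quad\text{for all } t_1,t_2\in\mathbb{R},\ x_1,x_2\in\mathbb{R}^n.$$ Assume that there is a constant $M_f\ge 0$ such that $$\|f(t,x)\|\le M_f\quad\text{for all } t\in\mathbb{R},\ x\in\bigcup_{s\in\mathbb{R}}C(s),$$ and that there is a constant $\alpha>0$ such that $$\langle f(t,x_1)-f(t,x_2),x_1-x_2\rangle\ge\alpha\|x_1-x_2\|^2\quad\text{for all } t\in\mathbb{R},\ x_1,x_2\in\mathbb{R}^n,$$ with $$\alpha>\frac{L_C+M_f}{\eta}.$$ Let $x_0$ be the unique solution defined on all of $\mathbb{R}$ of the sweeping process $$-\dot x\in N(C(t),x)+f(t,x)$$ (under these hypotheses such a solution exists and is unique). Let $T>0$. If both $t\mapsto C(t)$ and, for each $x\in\mathbb{R}^n$, $t\mapsto f(t,x)$ are $T$-periodic, then $x_0$ is $T$-periodic.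
   Context: Norms and inner products are Euclidean. For a closed set $C\subset\mathbb{R}^n$, $\mathrm{proj}(y,C)$ is the set of points of $C$ closest to $y$. For $x\in C$ the (proximal) normal cone is $N(C,x)=\{v\in\mathbb{R}^n:\ x\in\mathrm{proj}(x+av,C)\text{ for some }a>0\}$. For $\eta>0$, a closed set $C$ is $\eta$-prox-regular if it admits external tangent balls of radius $\eta$ at its boundary points: for every $x\in\partial C$ and every nonzero $v\in N(C,x)$, the open ball of radius $\eta$ centered at $x+\eta v/\|v\|$ does not intersect $C$. The Hausdorff distance is $d_H(C_1,C_2)=\max\{\sup_{x\in C_2}\mathrm{dist}(x,C_1),\ \sup_{x\in C_1}\mathrm{dist}(x,C_2)\}$, where $\mathrm{dist}(x,C)=\inf\{\|x-c\|:c\in C\}$. A solution of the sweeping process on an interval $I\subset\mathbb{R}$ is a function $x:I\to\mathbb{R}^n$, absolutely continuous (on compact subintervals of $I$), such that $x(t)\in C(t)$ for all $t\in I$ and $-\dot x(t)\in N(C(t),x(t))+f(t,x(t))$ for a.e. $t\in I$. A map $g$ on $\mathbb{R}$ is $T$-periodic if $g(t+T)=g(t)$ for all $t\in\mathbb{R}$. *)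

(* Defs.v *)
From HB Require Import structures.
From mathcomp Require Export all_boot all_order all_algebra.
From mathcomp Require Export all_classical all_reals all_analysis.
Export numFieldNormedType.Exports.

Set Implicit Arguments.
Unset Strict Implicit.
Unset Printing Implicit Defensive.

Import Order.TTheory GRing.Theory Num.Theory.

Local Open Scope classical_set_scope.
Local Open Scope ring_scope.

(* R^n is 'rV[R]_n.  The library norm `|x| on 'rV[R]_n is the sup norm: it is
   used below only through the topology and the derivative it induces, which
   are the Euclidean ones.  All metric notions use enorm. *)
Section Sweeping.
Context {R : realType} {n : nat}.
Implicit Types (u v x y : 'rV[R]_n) (C : set 'rV[R]_n).

Definition dot u v : R := \sum_(i < n) u ord0 i * v ord0 i.

Definition enorm u : R := Num.sqrt (dot u u).

Definition proj y C : set 'rV[R]_n :=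
  [set x | C x /\ forall c, C c -> enorm (y - x) <= enorm (y - c)].

Definition normal_cone C x : set 'rV[R]_n :=
  [set v | exists2 a : R, 0 < a & proj (x + a *: v) C x].

Definition boundary C : set 'rV[R]_n := closure C `\` interior C.

Definition prox_regular (eta : R) C : Prop :=
  closed C /\
  forall x v, boundary C x -> normal_cone C x v -> v != 0 ->
    [set y | enorm (y - (x + (eta / enorm v) *: v)) < eta] `&` C = set0.

Definition dist x C : \bar R := ereal_inf [set (enorm (x - c))%:E | c in C].

Definition hausdorff_dist C1 C2 : \bar R :=
  Order.max (ereal_sup [set dist x C1 | x in C2])
            (ereal_sup [set dist x C2 | x in C1]).

Definition absolutely_continuous (a b : R) (x : R -> 'rV[R]_n) : Prop :=
  forall eps : R, 0 < eps -> exists2 delta : R, 0 < delta &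
    forall (N : nat) (s t : 'I_N -> R),
      (forall i, a <= s i /\ s i <= t i /\ t i <= b) ->
      trivIset [set: 'I_N] (fun i => `]s i, t i[%classic) ->
      \sum_(i < N) (t i - s i) < delta ->
      \sum_(i < N) enorm (x (t i) - x (s i)) < eps.

(* The values of x outside I are irrelevant: the derivative of x at an interior
   point of I only depends on x on I, and the endpoints of I form a null set. *)
Definition sweeping_solution (C : R -> set 'rV[R]_n)
    (f : R -> 'rV[R]_n -> 'rV[R]_n) (I : interval R) (x : R -> 'rV[R]_n) :
    Prop :=
  [/\ forall a b : R, a <= b -> a \in I -> b \in I ->
        absolutely_continuous a b x,
      forall t : R, t \in I -> C t (x t) &
      {ae (@lebesgue_measure R), forall t : R, t \in I ->
        derivable x t 1 /\
        exists2 v, normal_cone (C t) (x t) v & - derive1 x t = v + f t (x t)}].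

End Sweeping.

(* Main.v *)
Require Import Defs.
From mathcomp Require Import ring lra.

Set Implicit Arguments.
Unset Strict Implicit.

Import Order.TTheory GRing.Theory Num.Theory.

Local Open Scope classical_set_scope.
Local Open Scope ring_scope.

(* Put [z t = x0 (t + T) - x0 t]; by periodicity both terms solve the same
   sweeping process.  The normal component of the velocity of a solution has
   norm at most [L_C + M_f]; hence [x0] is Lipschitz and [z] is bounded.
   Prox-regularity makes the normal cone hypomonotone with constant
   [(L_C + M_f) / eta < alpha], so that [|z|^2] satisfies a.e.
   [(|z|^2)' <= - 2 b |z|^2] with [b = alpha - (L_C + M_f) / eta > 0].  A bounded
   nonnegative function on the whole line with this property vanishes: being
   nonincreasing, it would otherwise decrease on all of [(-oo, t]] at a rate of
   at least [2 b |z t|^2]. *)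

(** * Real induction, null sets and slope bounds almost everywhere *)

(** One step at the supremum of the points satisfying [P] suffices: it leads from such a point close
    to the supremum either beyond it, which is absurd, or to [b]. *)
Lemma real_induction (R : realType) (a b : R) (P : R -> Prop) :
  a <= b -> P a ->
  (forall t, a <= t <= b -> exists2 r, 0 < r &
    forall u v, a <= u <= t -> t <= v <= b -> t - r < u -> v < t + r ->
      P u -> P v) ->
  P b.
Proof.
move=> ab Pa step; pose S := [set t | a <= t <= b /\ P t].
have Sa : S a by split=> //; rewrite lexx.
have ubS : ubound S b by move=> t [/andP[]].
have supS : has_sup S by split; [exists a|exists b].
have aS : a <= sup S by apply: sup_upper_bound.
have Sb : sup S <= b by apply: ge_sup => //; exists a.
have [|r r0 stepr] := step (sup S); first by rewrite aS.
have [u Su ur] := sup_adherent r0 supS.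
have uS : u <= sup S by apply: sup_upper_bound.
have [/andP[au ub] Pu] := Su.
have [bS|Sltb] := leP b (sup S + r / 2).
  apply: (stepr u b) => //; rewrite ?au ?uS ?Sb ?lexx//; lra.
have : S (sup S + r / 2).
  split; first by apply/andP; split; lra.
  by apply: (stepr u) => //; rewrite ?au ?uS//; lra.
by move/(sup_upper_bound supS); lra.
Qed.

(** Outer regularity gives an open [U] around [D] of measure below [d]; disjoint intervals inside
    [U] have total length at most that measure. *)
Lemma null_sum_itv_lt (R : realType) (D : set (measurableTypeR R)) (d : R) :
  measurable D -> lebesgue_measure D = 0%E -> 0 < d ->
  exists U : set R, [/\ open U, D `<=` U &
    forall (N : nat) (s t : 'I_N -> R),
      (forall i, s i <= t i /\ `]s i, t i[ `<=` U) ->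
      trivIset [set: 'I_N] (fun i => `]s i, t i[%classic) ->
      \sum_(i < N) (t i - s i) < d].
Proof.
move=> mD D0 d0.
have Dfin : (lebesgue_measure D < +oo)%E by rewrite D0.
have [U [oU DU UD]] := lebesgue_regularity_outer mD Dfin d0.
have mU : measurable (U : set (measurableTypeR R)).
  exact: measurable_realfun.open_measurable.
exists U; split=> // N s t st triv.
have muU : (lebesgue_measure (U : set (measurableTypeR R)) < d%:E)%E.
  have -> : U = D `|` (U `\` D) by rewrite setDUK.
  apply: le_lt_trans UD.
  rewrite -[leRHS]add0e -D0; apply: measureU2 => //; exact: measurableD.
rewrite -lte_fin; apply: le_lt_trans muU.
have -> : ((\sum_(i < N) (t i - s i))%:E =
    \sum_(i < N) lebesgue_measure (`]s i, t i[%classic : set (measurableTypeR R)))%E.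
  rewrite -sumEFin; apply: eq_bigr => i _.
  rewrite lebesgue_measure_itv/= lte_fin; case: ltP => // ts.
  by have [st' _] := st i; congr EFin; lra.
rewrite -measure_bigsetU_ord//; apply: le_measure; rewrite ?inE//.
  by apply: bigsetU_measurable => i _; exact: measurable_itv.
by elim/big_ind : _ => // [A B AU BU|i _]; [rewrite subUset|exact: (st i).2].
Qed.

(* A tagged partition of [a, b] is built by real induction: intervals tagged
   outside the null set satisfy the slope bound, and the others lie in an open
   set of small measure, where absolute continuity controls them. *)
Lemma ae_slope_le (R : realType) (h : R -> R) (K a b : R) :
  a <= b -> 0 <= K ->
  (forall eps, 0 < eps -> exists2 delta, 0 < delta &
    forall (N : nat) (s t : 'I_N -> R),
      (forall i, a <= s i /\ s i <= t i /\ t i <= b) ->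
      trivIset [set: 'I_N] (fun i => `]s i, t i[%classic) ->
      \sum_(i < N) (t i - s i) < delta ->
      \sum_(i < N) (h (t i) - h (s i)) < eps) ->
  {ae (@lebesgue_measure R), forall t : R, a <= t <= b ->
    forall e, 0 < e -> exists2 r, 0 < r &
      forall u v, a <= u <= t -> t <= v <= b -> t - r < u -> v < t + r ->
        h v - h u <= (K + e) * (v - u)} ->
  h b - h a <= K * (b - a).
Proof.
move=> ab K0 ac [D [mD D0 badD]].
apply/ler_addgt0Pr => eps eps0.
(* Half of [eps] goes to the slopes and half to the bad intervals; the [+ 1] covers [a = b]. *)
pose e := eps / 2 / (b - a + 1).
have e0 : 0 < e by rewrite !divr_gt0//; lra.
have [d d0 acd] := ac (eps / 2) ltac:(lra).
have [U [oU DU Usum]] := null_sum_itv_lt mD D0 d0.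
(* [L] records only the intervals tagged in the null set, the latest one first; all others are
   absorbed in the term [(K + e) * (t - a)]. *)
pose P t := exists L : seq (R * R), [/\
  forall p, p \in L -> [/\ a <= p.1, p.1 <= p.2, p.2 <= t & `]p.1, p.2[ `<=` U],
  pairwise (fun p q => q.2 <= p.1) L &
  h t - h a <= (K + e) * (t - a) + \sum_(p <- L) (h p.2 - h p.1)].
have : P b.
  apply: (@real_induction R a b) => //.
    by exists [::]; split=> //; rewrite big_nil; lra.
  move=> t tab; have [Dt|nDt] := pselect (D t).
    have /nbhs_ballP[r /= r0 rU] : nbhs t U.
      by apply: open_nbhs_nbhs; split=> //; exact: DU.
    exists (r / 2) => [|u v /andP[au ut] /andP[tv vb] tu vt [L [Lin Lpw Lh]]].
      lra.
    exists ((u, v) :: L); split => [p|/=|].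
    - rewrite inE => /orP[/eqP->/=|/Lin[? ? ? ?]]; last by split=> //; lra.
      split=> //; [lra|].
      move=> z /=; rewrite in_itv/= => /andP[uz zv].
      by apply: rU; rewrite /ball/= ltr_distl; apply/andP; split; lra.
    - rewrite Lpw andbT; apply/allP => q /Lin[_ _ ? _] /=; lra.
    (* Since [0 <= K], crossing a bad interval only enlarges the linear term. *)
    - rewrite big_cons/=; have : (K + e) * u <= (K + e) * v by rewrite ler_wpM2l//; lra.
      lra.
  have : ~ (~` [set t | a <= t <= b -> forall e, 0 < e -> exists2 r, 0 < r &
      forall u v, a <= u <= t -> t <= v <= b -> t - r < u -> v < t + r ->
        h v - h u <= (K + e) * (v - u)]) t by move/badD.
  move/contrapT => /(_ tab e e0)[r r0 slope].
  exists r => // u v /andP[au ut] /andP[tv vb] tu vt [L [Lin Lpw Lh]].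
  exists L; split=> // [p /Lin[? ? ? ?]|]; first by split=> //; lra.
  have := slope u v; rewrite au ut tv vb => /(_ isT isT tu vt); lra.
case=> L [Lin Lpw Lh].
(* The default [(0, 0)] is never reached, as the indices are below [size L]. *)
pose s (i : 'I_(size L)) := (nth (0, 0) L i).1.
pose t (i : 'I_(size L)) := (nth (0, 0) L i).2.
have triv : trivIset [set: 'I_(size L)] (fun i => `]s i, t i[%classic).
  have disj (i j : 'I_(size L)) : (i < j)%N -> t j <= s i.
    by move=> ij; apply: (pairwiseP (0, 0) Lpw); rewrite ?inE.
  move=> i j _ _ [z /= []]; rewrite !in_itv/= => /andP[? ?] /andP[? ?].
  apply: val_inj; apply/eqP; case: ltngtP => // /disj; lra.
have lenL : \sum_(i < size L) (t i - s i) < d.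
  by apply: Usum => // i; have [] := Lin _ (mem_nth (0, 0) (ltn_ord i)).
have hyp (i : 'I_(size L)) : a <= s i /\ s i <= t i /\ t i <= b.
  by have [] := Lin _ (mem_nth (0, 0) (ltn_ord i)).
have := acd _ s t hyp triv lenL.
have := Lh; rewrite (big_nth (0, 0)) big_mkord -/(\sum_(i < size L) (h (t i) - h (s i))).
have mul_le : e * (b - a) <= eps / 2.
  by rewrite /e mulrAC ler_pdivrMr ?ler_wpM2l//; lra.
lra.
Qed.

(** The pushforward of Lebesgue measure under a translation agrees with it on half-open intervals,
    hence everywhere by uniqueness; so translations preserve null sets. *)
Lemma ae_shift (R : realType) (P : R -> Prop) (c : R) :
  {ae (@lebesgue_measure R), forall t, P t} ->
  {ae (@lebesgue_measure R), forall t, P (t + c)}.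
Proof.
move=> [D [mD D0 badD]].
have mshift : measurable_fun setT
    ((fun t : R => t + c) : measurableTypeR R -> measurableTypeR R).
  by apply: measurable_realfun.measurable_funD => //.
exists ((fun t : R => t + c) @^-1` D); split => [||t nPt].
- by rewrite -[X in measurable X]setTI; exact: mshift.
- rewrite -[LHS]/(pushforward lebesgue_measure
    ((fun t : R => t + c) : _ -> measurableTypeR R) D) -D0.
  apply/esym/lebesgue_measure_unique => //= _ [[a b]] _ <-.
  rewrite /pushforward.
  have -> : (fun t : R => t + c) @^-1` `]a, b] = `]a - c, b - c]%classic.
    apply/seteqP; split=> z /=; rewrite !in_itv/= => /andP[? ?];
      by apply/andP; split; lra.
  rewrite !lebesgue_measure_itv/= !lte_fin ltrD2r; case: ifP => // _.
  by congr EFin; lra.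
- exact: badD.
Qed.

(** * Euclidean inner product and norm on row vectors *)

Section Euclidean.
Context {R : realType} {n : nat}.
Implicit Types (u v w : 'rV[R]_n) (k : R).

Lemma dotC u v : dot u v = dot v u.
Proof. by apply: eq_bigr => i _; rewrite mulrC. Qed.

Lemma dotDl u v w : dot (u + v) w = dot u w + dot v w.
Proof. by rewrite -big_split; apply: eq_bigr => i _; rewrite mxE mulrDl. Qed.

Lemma dotZl k u v : dot (k *: u) v = k * dot u v.
Proof. by rewrite mulr_sumr; apply: eq_bigr => i _; rewrite mxE mulrA. Qed.

Lemma dotNl u v : dot (- u) v = - dot u v.
Proof. by rewrite -scaleN1r dotZl mulN1r. Qed.

Lemma dotDr u v w : dot u (v + w) = dot u v + dot u w.
Proof. by rewrite dotC dotDl ![dot _ u]dotC. Qed.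

Lemma dotZr k u v : dot u (k *: v) = k * dot u v.
Proof. by rewrite dotC dotZl dotC. Qed.

Lemma dotNr u v : dot u (- v) = - dot u v.
Proof. by rewrite dotC dotNl dotC. Qed.

Definition dotE := (dotDl, dotDr, dotNl, dotNr, dotZl, dotZr).

Lemma dot_ge0 u : 0 <= dot u u.
Proof. by apply: sumr_ge0 => i _; rewrite -expr2 sqr_ge0. Qed.

Lemma enorm_ge0 u : 0 <= enorm u.
Proof. exact: sqrtr_ge0. Qed.

Lemma enorm_sqr u : enorm u ^+ 2 = dot u u.
Proof. by rewrite sqr_sqrtr ?dot_ge0. Qed.

Lemma dot_eq0 u : dot u u = 0 -> u = 0.
Proof.
move/eqP; rewrite psumr_eq0 => [/allP u0|i _]; last by rewrite -expr2 sqr_ge0.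
apply/rowP => i; rewrite mxE; apply/eqP.
by have := u0 i (mem_index_enum i); rewrite mulf_eq0 orbb.
Qed.

Lemma enorm_eq0 u : enorm u = 0 -> u = 0.
Proof. by move=> u0; apply: dot_eq0; rewrite -enorm_sqr u0 expr0n. Qed.

Lemma dot0l v : dot 0 v = 0.
Proof. by rewrite -(scale0r 0) dotZl mul0r. Qed.

Lemma dot_le_enorm u v : dot u v <= enorm u * enorm v.
Proof.
have [u0|u0] := eqVneq (enorm u) 0.
  by rewrite (enorm_eq0 u0) dot0l mulr_ge0 ?enorm_ge0.
have [v0|v0] := eqVneq (enorm v) 0.
  by rewrite (enorm_eq0 v0) dotC dot0l mulr_ge0 ?enorm_ge0.
have uv0 : 0 < enorm u * enorm v by rewrite mulr_gt0 ?lt0r ?u0 ?v0 ?enorm_ge0.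
(* Expanding this square leaves [2 * (enorm u * enorm v)] times the wanted difference. *)
have := dot_ge0 (enorm v *: u - enorm u *: v).
rewrite !dotE (dotC v u) -!enorm_sqr => le0.
rewrite -(ler_pM2l uv0); lra.
Qed.

Lemma dot_ge_enorm u v : - (enorm u * enorm v) <= dot u v.
Proof.
have := dot_le_enorm (- u) v.
by rewrite dotNl lerNl /enorm dotNl dotNr opprK.
Qed.

Lemma enormD u v : enorm (u + v) <= enorm u + enorm v.
Proof.
rewrite -(@ler_pXn2r _ 2) ?nnegrE ?addr_ge0 ?enorm_ge0//.
rewrite enorm_sqr !dotE (dotC v u) sqrrD !enorm_sqr.
have := dot_le_enorm u v; lra.
Qed.

Lemma enormZ k u : enorm (k *: u) = `|k| * enorm u.
Proof. by rewrite /enorm !dotE mulrA -expr2 sqrtrM ?sqr_ge0// sqrtr_sqr. Qed.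

Lemma enormN u : enorm (- u) = enorm u.
Proof. by rewrite -scaleN1r enormZ normrN1 mul1r. Qed.

Lemma enormB u v : enorm (u - v) <= enorm u + enorm v.
Proof. by rewrite -(enormN v) enormD. Qed.

Lemma enorm_distC u v : enorm (u - v) = enorm (v - u).
Proof. by rewrite -enormN opprB. Qed.

(** Each of the [n] squared entries is at most the squared sup norm, and [n <= n^2]; this crude
    constant is enough to transfer limits to [enorm]. *)
Lemma enorm_le_normr u : enorm u <= n%:R * `|u|.
Proof.
rewrite -(@ler_pXn2r _ 2) ?nnegrE ?mulr_ge0 ?enorm_ge0//.
rewrite enorm_sqr; apply: (@le_trans _ _ (\sum_(i < n) `|u| ^+ 2)).
  apply: ler_sum => i _; rewrite -expr2 -real_normK ?num_real//.
  rewrite ler_pXn2r ?nnegrE//.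
  by rewrite [leRHS]/Num.Def.normr/= mx_normrE; apply: (le_bigmax _ _ (ord0, i)).
rewrite sumr_const card_ord exprMn -[leLHS]mulr_natl ler_wpM2r ?sqr_ge0//.
by rewrite -natrX ler_nat; case: (n) => // m; rewrite leq_pmulr.
Qed.

Lemma derive1_enorm (x : R -> 'rV[R]_n) t : derivable x t 1 ->
  forall e, 0 < e -> exists2 r, 0 < r & forall s, `|s - t| < r ->
    enorm (x s - x t - (s - t) *: derive1 x t) <= e * `|s - t|.
Proof.
move=> dx e e0; have n1 : 0 < n%:R + 1 :> R by rewrite ltr_wpDl.
have : h^-1 *: (x (h *: 1 + t) - x t) @[h --> 0^'] --> derive1 x t.
  by rewrite derive1E; exact: dx.
(* Dividing by [n + 1] absorbs the factor [n] of [enorm_le_normr], also when [n = 0]. *)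
move/cvgrPdist_le => /(_ (e / (n%:R + 1)) (divr_gt0 e0 n1))[r /= r0 xr].
exists r => // s st; have [->|sNt] := eqVneq s t.
  by rewrite !subrr scale0r subr0 -(scale0r 0) enormZ normr0 mul0r mulr0.
have st0 : s - t != 0 by rewrite subr_eq0.
have := xr (s - t); rewrite /= sub0r normrN => /(_ st st0).
rewrite scaler1 subrK => le1.
set d := derive1 x t in le1 *.
have -> : x s - x t - (s - t) *: d = - (s - t) *: (d - (s - t)^-1 *: (x s - x t)).
  by rewrite scalerBr scalerA mulNr mulfV// scaleN1r opprK scaleNr addrC.
rewrite enormZ normrN mulrC ler_wpM2r//.
apply: le_trans (enorm_le_normr _) _.
apply: le_trans (ler_wpM2l _ le1) _ => //.
rewrite mulrCA ger_pMr// ler_pdivrMr// mul1r; lra.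
Qed.

End Euclidean.

(** * Prox-regular sets and the size of the normal velocity *)

Section ProxRegular.
Context {R : realType} {n : nat}.
Implicit Types (u v w x c : 'rV[R]_n) (C : set 'rV[R]_n).

(** From an interior point one could move slightly along [v] inside [C] and get closer to
    [x + a *: v], so [x] would not be a projection. *)
Lemma normal_cone_boundary C x v :
  normal_cone C x v -> v != 0 -> boundary C x.
Proof.
move=> [a a0 [Cx minx]] v0; split; first exact: subset_closure.
move=> /nbhs_ballP[r /= r0 rC].
have nv : 0 < `|v| by rewrite normr_gt0.
(* Small enough to stay in the sup-norm ball around [x] without overshooting [x + a *: v]. *)
pose s := Num.min a (r / 2 / `|v|).
have s0 : 0 < s by rewrite lt_min a0 !divr_gt0.
have /minx : C (x + s *: v).
  apply: rC; rewrite -ball_normE /= opprD addrA subrr sub0r normrN normrZ gtr0_norm//.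
  apply: (@le_lt_trans _ _ (r / 2 / `|v| * `|v|)); last by rewrite divfK ?gt_eqF//; lra.
  by rewrite ler_wpM2r// ge_min lexx orbT.
have -> : x + a *: v - x = a *: v by rewrite addrAC subrr add0r.
have -> : x + a *: v - (x + s *: v) = (a - s) *: v.
  by rewrite opprD addrACA subrr add0r scalerBl.
have sa : s <= a by rewrite ge_min lexx.
rewrite !enormZ (gtr0_norm a0) ger0_norm ?subr_ge0//.
have : 0 < enorm v.
  by rewrite lt0r enorm_ge0 andbT; apply: contra_neq v0; exact: enorm_eq0.
by move=> /ler_pM2r->; lra.
Qed.

(** The tangent ball of radius [eta] along [v] misses [c]; squaring this distance inequality and
    cancelling [eta ^+ 2] leaves the quadratic bound. Used at two points, it gives hypomonotonicity
    of the normal cone. *)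
Lemma prox_regular_dot eta C x v c : 0 < eta -> prox_regular eta C ->
  normal_cone C x v -> C c ->
  dot v (c - x) <= enorm v / (2 * eta) * enorm (c - x) ^+ 2.
Proof.
move=> eta0 [_ prC] Nv Cc; have [->|v0] := eqVneq v 0.
  by rewrite dot0l mulr_ge0 ?exprn_ge0 ?divr_ge0 ?enorm_ge0//; lra.
have nv : 0 < enorm v.
  by rewrite lt0r enorm_ge0 andbT; apply: contra_neq v0; exact: enorm_eq0.
have : eta <= enorm (c - (x + (eta / enorm v) *: v)).
  rewrite leNgt; apply/negP => lt_eta.
  have := prC _ _ (normal_cone_boundary Nv v0) Nv v0.
  by rewrite -subset0 => /(_ c); apply.
rewrite opprD addrA -(@ler_pXn2r _ 2) ?nnegrE ?enorm_ge0 ?(ltW eta0)//.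
rewrite [leRHS]enorm_sqr; move: (c - x) => d.
rewrite !dotE (dotC d v) -!enorm_sqr.
set N := enorm v in nv *; set D := enorm d ^+ 2; set p := dot v d.
have -> : eta / N * (eta / N * N ^+ 2) = eta ^+ 2.
  by rewrite mulrA -[X in X * _]expr2 -exprMn divfK ?gt_eqF.
move=> le_eta; have {}le_eta : 2 * (eta / N) * p <= D by lra.
rewrite -(@ler_pM2l _ (2 * (eta / N))) ?mulr_gt0 ?invr_gt0//.
suff -> : 2 * (eta / N) * (N / (2 * eta) * D) = D by [].
by field; rewrite !gt_eqF.
Qed.

Lemma hausdorff_dist_near C1 C2 x r e : (hausdorff_dist C1 C2 <= r%:E)%E ->
  C1 x -> 0 < e -> exists2 c, C2 c & enorm (x - c) < r + e.
Proof.
rewrite /hausdorff_dist ge_max => /andP[_ le_r] C1x e0.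
have : (dist x C2 < (r + e)%:E)%E.
  apply: (@le_lt_trans _ _ r%:E); last by rewrite lte_fin ltrDl.
  by apply: le_trans le_r; apply: ereal_sup_ubound; exists x.
by move=> /ereal_inf_lt[_ [c C2c <-]]; rewrite lte_fin; exists c.
Qed.

(** Allows an error linear in [e], with [e <= 1] available to tame higher-order terms. *)
Lemma ler_small_mul (a b B : R) : 0 <= B ->
  (forall e, 0 < e -> e <= 1 -> a <= b + e * B) -> a <= b.
Proof.
move=> B0 ab; apply/ler_addgt0Pr => e e0.
have eB : 0 < e / (B + 1) by rewrite divr_gt0//; lra.
have := ab (Num.min 1 (e / (B + 1))).
rewrite lt_min ltr01 eB ge_min lexx => /(_ isT isT) /le_trans; apply.
rewrite lerD2l; apply: (@le_trans _ _ (e / (B + 1) * B)).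
  by rewrite ler_wpM2r// ge_min lexx orbT.
by rewrite mulrAC ler_pdivrMr ?ler_wpM2l//; lra.
Qed.

(* Compare backward in time: [x (t - h)] is within [L h] of [C t], and moving
   inside [C t] has a component along [v] of second order in [h]. *)
Lemma normal_velocity_le (eta L M t : R) (C : R -> set 'rV[R]_n)
    (x : R -> 'rV[R]_n) v w :
  0 < eta -> prox_regular eta (C t) -> 0 <= L ->
  (forall s, (hausdorff_dist (C s) (C t) <= (L * `|s - t|)%:E)%E) ->
  (forall s, C s (x s)) -> derivable x t 1 -> normal_cone (C t) (x t) v ->
  - derive1 x t = v + w -> enorm w <= M ->
  enorm v <= L + M.
Proof.
move=> eta0 prC L0 lipC Cx dx Nv eqd wM.
set d := derive1 x t in eqd *; pose k := enorm v / (2 * eta).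
have v0 := enorm_ge0 v; have d0 := enorm_ge0 d.
have k0 : 0 <= k by rewrite divr_ge0 ?enorm_ge0//; lra.
(* [A * h] will bound [enorm (c - x t)]: [L * h] and [h * enorm d] are the main terms, and the
   derivative remainder and the slack [h ^+ 2] cost at most [h] each. *)
pose A := L + enorm d + 2.
have A0 : 0 <= A by rewrite /A; lra.
have vd : - dot v d <= enorm v * L.
  (* The error collects [|v| e] from the derivative, [|v| h] from the Hausdorff slack and [k A^2 h]
     from prox-regularity, with [h <= e]. *)
  apply: (@ler_small_mul _ _ (2 * enorm v + k * A ^+ 2)) => [|e e0 e1].
    have := mulr_ge0 k0 (exprn_ge0 2 A0); lra.
  have [r r0 xr] := derive1_enorm dx e0.
  pose h := Num.min e (r / 2).
  have h0 : 0 < h by rewrite lt_min e0 divr_gt0.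
  have he : h <= e by rewrite ge_min lexx.
  have hr : h < r.
    by apply: (@le_lt_trans _ _ (r / 2)); [rewrite ge_min lexx orbT|lra].
  have th : `|t - h - t| = h by rewrite addrAC subrr sub0r normrN gtr0_norm.
  have := xr (t - h); rewrite th => /(_ hr).
  rewrite (_ : t - h - t = - h); last lra.
  rewrite scaleNr opprK -/d => le_rho.
  (* The slack [h ^+ 2] stands in for attainment of the distance and is negligible against [h]. *)
  have hh0 : 0 < h ^+ 2 by rewrite exprn_gt0.
  have [c Cc xc] := hausdorff_dist_near (lipC (t - h)) (Cx _) hh0.
  rewrite th in xc.
  set rho := _ - _ + _ in le_rho.
  set q := x (t - h) - c in xc.
  have cE : c - x t = rho - h *: d - q.
    by rewrite /rho /q addrK opprB [RHS]addrC subrKA.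
  have c_le : enorm (c - x t) <= A * h.
    rewrite cE; apply: le_trans (enormB _ _) _.
    have := enormB rho (h *: d); rewrite enormZ gtr0_norm//.
    have : h ^+ 2 <= h by rewrite expr2 ler_piMl//; lra.
    have : e * h <= h by rewrite ler_piMl//; lra.
    rewrite /A; lra.
  have := prox_regular_dot eta0 prC Nv Cc; rewrite -/k.
  have : k * enorm (c - x t) ^+ 2 <= k * (A * h) ^+ 2.
    by rewrite ler_wpM2l// ler_pXn2r ?nnegrE ?enorm_ge0 ?mulr_ge0//; lra.
  have : dot v (c - x t) = dot v rho - h * dot v d - dot v q by rewrite cE !dotE.
  move=> -> le1 le2.
  have le3 := dot_ge_enorm v rho; have le4 := dot_le_enorm v q.
  have le5 : enorm v * enorm rho <= enorm v * (e * h) by rewrite ler_wpM2l.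
  have le6 : enorm v * enorm q <= enorm v * (L * h + h ^+ 2) by rewrite ler_wpM2l// ltW.
  have le7 : h * - dot v d <= h * (enorm v * e + enorm v * (L + h) + k * A ^+ 2 * h).
    lra.
  move: le7; rewrite (ler_pM2l h0) => le7.
  have : enorm v * h <= enorm v * e by rewrite ler_wpM2l.
  have : k * A ^+ 2 * h <= k * A ^+ 2 * e by rewrite ler_wpM2l// mulr_ge0 ?exprn_ge0.
  lra.
(* Pairing [- x' = v + w] with [v] turns [vd] into this inequality. *)
have : enorm v * enorm v <= enorm v * (L + M).
  have := dot_ge_enorm v w; have : enorm v * enorm w <= enorm v * M by rewrite ler_wpM2l.
  move: vd; rewrite -dotNr eqd dotDr -enorm_sqr; lra.
have [->|vN0] := eqVneq (enorm v) 0; last by rewrite ler_pM2l// lt0r vN0.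
by have := enorm_ge0 w; lra.
Qed.

End ProxRegular.

(** * Increments from derivatives almost everywhere *)

#[local] Instance lebesgue_ae_filter (R : realType) :
  Filter (nbhs (almost_everywhere (@lebesgue_measure R))).
Proof. exact: (ae_filter_ringOfSetsType (@lebesgue_measure R)). Qed.

(** Subtracting the expansions at [v] and [u] gives an increment over an interval around [t], the
    form that the slope lemmas take. *)
Lemma derive1_increment (R : realType) (n : nat) (x : R -> 'rV[R]_n) t :
  derivable x t 1 ->
  forall e, 0 < e -> exists2 r, 0 < r &
    forall u v, u <= t -> t <= v -> t - r < u -> v < t + r ->
      enorm (x v - x u - (v - u) *: derive1 x t) <= e * (v - u).
Proof.
move=> dx e e0; have [r r0 xr] := derive1_enorm dx e0.
exists r => // u v ut tv tu vt.
have := xr v; rewrite ger0_norm ?subr_ge0// => /(_ ltac:(lra)) lev.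
have := xr u; rewrite ler0_norm ?subr_le0// => /(_ ltac:(lra)) leu.
set d := derive1 x t in lev leu *.
have -> : x v - x u - (v - u) *: d =
    (x v - x t - (v - t) *: d) - (x u - x t - (u - t) *: d).
  by clearbody d; apply/rowP => i; rewrite !mxE; ring.
by apply: le_trans (enormB _ _) _; lra.
Qed.

(** Projecting the curve on [w = x b - x a] reduces to [ae_slope_le] with slope [K |w|]; the
    increment is then [|w|^2], and one factor cancels. *)
Lemma ac_derive1_lipschitz (R : realType) (n : nat) (x : R -> 'rV[R]_n) (K a b : R) :
  a <= b -> 0 <= K -> absolutely_continuous a b x ->
  {ae (@lebesgue_measure R), forall t : R,
    derivable x t 1 /\ enorm (derive1 x t) <= K} ->
  enorm (x b - x a) <= K * (b - a).
Proof.
move=> ab K0 acx aex; set w := x b - x a.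
have w0 := enorm_ge0 w.
have hE u v : dot (x v) w - dot (x u) w = dot (x v - x u) w by rewrite !dotE.
have : dot (x b) w - dot (x a) w <= (K * enorm w) * (b - a).
  apply: (@ae_slope_le _ (fun t => dot (x t) w)) => //; first exact: mulr_ge0.
    move=> eps eps0; have [|d d0 acd] := acx (eps / (enorm w + 1)).
      by rewrite divr_gt0//; lra.
    exists d => // N s t st triv len.
    have := acd N s t st triv len; rewrite ltr_pdivlMr; last lra.
    apply: le_lt_trans; rewrite mulr_suml; apply: ler_sum => i _.
    rewrite hE; apply: le_trans (dot_le_enorm _ _) _.
    by rewrite ler_wpM2l ?enorm_ge0//; lra.
  apply: filterS aex => t [dx dK] _ e e0.
  have e1 : 0 < e / (enorm w + 1) by rewrite divr_gt0//; lra.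
  have [r r0 xr] := derive1_increment dx e1.
  exists r => // u v /andP[_ ut] /andP[tv _] tu vt.
  have := xr u v ut tv tu vt; set rho := _ - _ *: _ => le_rho.
  rewrite hE (_ : x v - x u = (v - u) *: derive1 x t + rho); last first.
    by rewrite /rho [RHS]addrC subrK.
  rewrite dotDl dotZl [leRHS]mulrDl; apply: lerD.
    rewrite mulrC ler_wpM2r//; first lra.
    by apply: le_trans (dot_le_enorm _ _) _; rewrite ler_wpM2r.
  apply: le_trans (dot_le_enorm _ _) _.
  apply: le_trans (ler_wpM2r w0 le_rho) _.
  rewrite mulrAC ler_wpM2r//; first lra.
  by rewrite mulrAC ler_pdivrMr ?ler_wpM2l//; lra.
rewrite hE -/w -enorm_sqr expr2 mulrAC => le_w.
have [->|wN0] := eqVneq (enorm w) 0; first by rewrite mulr_ge0//; lra.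
by rewrite -(@ler_pM2r _ (enorm w)) ?lt0r ?wN0.
Qed.

(** Subtracting [m * t] reduces to slope [0], so [m] may be negative, as the decay of [|z|^2]
    requires; the one-sided Lipschitz bound supplies the one-sided absolute continuity. *)
Lemma lipschitz_ae_slope_le (R : realType) (h : R -> R) (Lip m a b : R) :
  a <= b -> (forall u v, u <= v -> h v - h u <= Lip * (v - u)) ->
  {ae (@lebesgue_measure R), forall t : R, a <= t <= b ->
    forall e, 0 < e -> exists2 r, 0 < r &
      forall u v, a <= u <= t -> t <= v <= b -> t - r < u -> v < t + r ->
        h v - h u <= (m + e) * (v - u)} ->
  h b - h a <= m * (b - a).
Proof.
move=> ab lip slope.
suff : (h b - m * b) - (h a - m * a) <= 0 * (b - a) by lra.
apply: (@ae_slope_le _ (fun t => h t - m * t)) => //.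
  move=> eps eps0; pose B := `|Lip| + `|m| + 1.
  have B0 : 0 < B by rewrite ltr_wpDl// addr_ge0.
  exists (eps / B) => [|N s t st _]; first by rewrite divr_gt0.
  rewrite ltr_pdivlMr// => len; apply: le_lt_trans len.
  rewrite mulr_suml; apply: ler_sum => i _.
  have [_ [sti _]] := st i; have := lip _ _ sti.
  have : (Lip - m) * (t i - s i) <= B * (t i - s i).
    rewrite ler_wpM2r ?subr_ge0// /B.
    by have := ler_norm Lip; have := ler_norm (- m); rewrite normrN; lra.
  lra.
apply: filterS slope => t slope tab e e0.
have [r r0 sr] := slope tab e e0; exists r => // u v ut tv tu vt.
have := sr u v ut tv tu vt; lra.
Qed.

(** * Bounded dissipative curves on the whole line *)

Section Dissipation.
Context {R : realType} {n : nat}.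
Context (z : R -> 'rV[R]_n) (K B b : R).
Context (b0 : 0 < b)
  (z_lip : forall u v, u <= v -> enorm (z v - z u) <= K * (v - u))
  (z_bnd : forall t, enorm (z t) <= B)
  (z_diss : {ae (@lebesgue_measure R), forall t : R,
    derivable z t 1 /\ dot (derive1 z t) (z t) <= - b * enorm (z t) ^+ 2}).

Let K0 : 0 <= K.
Proof. by have := z_lip ler01; have := enorm_ge0 (z 1 - z 0); lra. Qed.

Let B0 : 0 <= B.
Proof. by have := z_bnd 0; have := enorm_ge0 (z 0); lra. Qed.

Let g t := enorm (z t) ^+ 2.

Let gE u v : g v - g u = dot (z v - z u) (z v + z u).
Proof. by rewrite /g !enorm_sqr !dotE (dotC (z u) (z v)); lra. Qed.

(** The derivative of [g] is [2 <z', z>], at most [- 2 b g] and hence at most [m] on [[p, q]]; [g]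
    is Lipschitz because [z] is bounded and Lipschitz. *)
Lemma dissipation_slope (m p q : R) : p <= q ->
  (forall t, p <= t <= q -> - (2 * b) * g t <= m) ->
  g q - g p <= m * (q - p).
Proof.
move=> pq gm; apply: (@lipschitz_ae_slope_le _ g (K * (2 * B))) => //.
  move=> u v uv; rewrite gE; apply: le_trans (dot_le_enorm _ _) _.
  rewrite mulrAC; apply: ler_pM; rewrite ?enorm_ge0 ?z_lip//.
  by apply: le_trans (enormD _ _) _; have := z_bnd u; have := z_bnd v; lra.
apply: filterS z_diss => t [dz diss] tpq e e0.
(* [e1] keeps the contribution of the first-order remainder to the slope below [e / 2], and [r1]
   below does the same for the quadratic term. *)
have K_ge0 := K0; have B_ge0 := B0; pose e1 := e / (4 * (B + 1)).
have e10 : 0 < e1 by rewrite divr_gt0//; lra.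
have [r r0 zr] := derive1_increment dz e10.
pose r1 := e / (4 * (K ^+ 2 + 1)).
have K20 : 0 <= K ^+ 2 by rewrite sqr_ge0.
have r10 : 0 < r1 by rewrite divr_gt0//; lra.
exists (Num.min r r1) => [|u v /andP[_ ut] /andP[tv _]]; first by rewrite lt_min r0.
rewrite ltrBlDr -ltrBlDl -ltrBlDl !lt_min => /andP[tu1 tu2] /andP[vt1 vt2].
have := zr u v ut tv ltac:(lra) ltac:(lra); set d := derive1 z t in diss *.
set rho := _ - _ *: _ => le_rho.
have uv0 : 0 <= v - u by lra.
(* Here [z v + z u] is [2 z t] plus a correction of order [v - u], which makes the last product of
   second order. *)
have gEt : g v - g u = 2 * (v - u) * dot d (z t) + 2 * dot rho (z t)
    + dot (z v - z u) ((z v - z t) - (z t - z u)).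
  by rewrite gE /rho !dotE; lra.
have le1 : (v - u) * (2 * dot d (z t)) <= (v - u) * m.
  by rewrite ler_wpM2l//; have := gm t tpq; rewrite /g; lra.
have le2 : dot rho (z t) <= e / 4 * (v - u).
  apply: le_trans (dot_le_enorm _ _) _.
  apply: (@le_trans _ _ (e1 * (v - u) * (B + 1))).
    by apply: ler_pM; rewrite ?enorm_ge0//; have := z_bnd t; lra.
  suff -> : e1 * (v - u) * (B + 1) = e / 4 * (v - u) by [].
  by rewrite /e1; field; lra.
have le3 : dot (z v - z u) ((z v - z t) - (z t - z u)) <= e / 2 * (v - u).
  apply: le_trans (dot_le_enorm _ _) _.
  apply: (@le_trans _ _ (K * (v - u) * (K * (v - u)))).
    apply: ler_pM; rewrite ?enorm_ge0 ?z_lip//; first lra.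
    by apply: le_trans (enormB _ _) _; have := z_lip ut; have := z_lip tv; lra.
  rewrite mulrA ler_wpM2r//; apply: (@le_trans _ _ ((K ^+ 2 + 1) * (2 * r1))).
    rewrite mulrAC -expr2; apply: ler_pM => //; lra.
  suff -> : (K ^+ 2 + 1) * (2 * r1) = e / 2 by [].
  by rewrite /r1; field; lra.
rewrite gEt; lra.
Qed.

Lemma dissipation_eq0 t : z t = 0.
Proof.
have g0 s : 0 <= g s by rewrite exprn_ge0 ?enorm_ge0.
have g_noninc p q : p <= q -> g q <= g p.
  move=> pq; suff : g q - g p <= 0 * (q - p) by lra.
  apply: dissipation_slope => // s _.
  by rewrite mulNr oppr_le0 mulr_ge0 ?g0//; have := b0; lra.
have gt0 : g t = 0.
  apply/eqP; rewrite eq_le g0 andbT leNgt; apply/negP => gt_pos.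
  (* Over a length [s], decay at rate [2 * b * g t] totals [B ^+ 2 + 1], more than the bound
     [B ^+ 2] on [g]. *)
  pose s := (B ^+ 2 + 1) / (2 * b * g t).
  have bg : 0 < 2 * b * g t by apply: mulr_gt0 => //; have := b0; lra.
  have s0 : 0 < s by rewrite divr_gt0// ltr_wpDl ?sqr_ge0.
  have : g t - g (t - s) <= (- (2 * b) * g t) * (t - (t - s)).
    apply: dissipation_slope; first lra.
    by move=> r /andP[_ rt]; rewrite !mulNr lerN2 ler_wpM2l ?g_noninc//; have := b0; lra.
  have : 2 * b * g t * s = B ^+ 2 + 1 by rewrite mulrC divfK ?gt_eqF.
  have : g (t - s) <= B ^+ 2 by rewrite ler_pXn2r ?nnegrE ?enorm_ge0.
  lra.
by apply: enorm_eq0; apply/eqP; rewrite -sqrf_eq0; apply/eqP.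
Qed.

End Dissipation.

(** * Time shifts and periodicity of the solution *)

Lemma derivable_shift (R : realType) (n : nat) (x : R -> 'rV[R]_n) (c t : R) :
  derivable x (t + c) 1 -> derivable (fun s => x (s + c)) t 1.
Proof.
suff E : (fun h : R => h^-1 *: (x (h *: 1 + (t + c)) - x (t + c))) =
    (fun h : R => h^-1 *: (x (h *: 1 + t + c) - x (t + c))).
  by rewrite {1}/derivable /= E.
by apply/funext => h; rewrite addrA.
Qed.

Lemma derive1_shift (R : realType) (n : nat) (x : R -> 'rV[R]_n) (c t : R) :
  derive1 (fun s => x (s + c)) t = derive1 x (t + c).
Proof.
suff E : (fun h : R => h^-1 *: (x (h + t + c) - x (t + c))) =
    (fun h : R => h^-1 *: (x (h + (t + c)) - x (t + c))).
  by rewrite /derive1 E.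
by apply/funext => h; rewrite addrA.
Qed.

Lemma derive1B (R : realType) (V : normedModType R) (x y : R -> V) (t : R) :
  derivable x t 1 -> derivable y t 1 ->
  derive1 (x - y) t = derive1 x t - derive1 y t.
Proof. by move=> dx dy; rewrite (derive1E (x - y)) deriveB// -!derive1E. Qed.

Theorem theorem3 (R : realType) (n : nat) (eta L_C L_f M_f alpha T : R)
    (C : R -> set 'rV[R]_n) (f : R -> 'rV[R]_n -> 'rV[R]_n)
    (x0 : R -> 'rV[R]_n) :
  (1 <= n)%N ->
  0 < eta ->
  (forall t, C t !=set0) ->
  (forall t, prox_regular eta (C t)) ->
  0 <= L_C ->
  (forall t1 t2, (hausdorff_dist (C t1) (C t2) <= (L_C * `|t1 - t2|)%:E)%E) ->
  0 < L_f ->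
  (forall (t1 t2 : R) (x1 x2 : 'rV[R]_n),
     enorm (f t1 x1 - f t2 x2) <= L_f * `|t1 - t2| + L_f * enorm (x1 - x2)) ->
  0 <= M_f ->
  (forall t x, (\bigcup_(s in [set: R]) C s) x -> enorm (f t x) <= M_f) ->
  0 < alpha ->
  (forall (t : R) (x1 x2 : 'rV[R]_n),
     dot (f t x1 - f t x2) (x1 - x2) >= alpha * enorm (x1 - x2) ^+ 2) ->
  alpha > (L_C + M_f) / eta ->
  sweeping_solution C f `]-oo, +oo[ x0 ->
  0 < T ->
  (forall t : R, C (t + T) = C t) ->
  (forall (x : 'rV[R]_n) (t : R), f (t + T) x = f t x) ->
  forall t : R, x0 (t + T) = x0 t.
Proof.
move=> _ eta0 _ prC L0 lipC _ _ M0 fM alpha0 fmono alpha_gt [ac0 C0 sol0] T0 perC perf t.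
have Cx s : C s (x0 s) by apply: C0; rewrite in_itv.
(* [V] bounds the normal component of the velocity, and [K] the full speed. *)
pose V := L_C + M_f; have V0 : 0 <= V by rewrite addr_ge0.
pose K := V + M_f; have K0 : 0 <= K by rewrite addr_ge0.
have sol : {ae (@lebesgue_measure R), forall t : R, derivable x0 t 1 /\
    exists v, [/\ normal_cone (C t) (x0 t) v, enorm v <= V &
      - derive1 x0 t = v + f t (x0 t)]}.
  apply: filterS sol0 => s /(_ ltac:(by rewrite in_itv))[dx [v Nv xv]].
  split=> //; exists v; split=> //.
  apply: (normal_velocity_le eta0 (prC s) L0 _ Cx dx Nv xv) => //.
  by apply: fM; exists s.
have lip u v : u <= v -> enorm (x0 v - x0 u) <= K * (v - u).
  move=> uv; apply: ac_derive1_lipschitz => //.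
    by apply: ac0; rewrite ?in_itv.
  apply: filterS sol => s [dx [w [_ wV xw]]]; split=> //.
  rewrite -enormN xw; apply: le_trans (enormD _ _) _.
  by apply: lerD => //; apply: fM; exists s.
pose z s := x0 (s + T) - x0 s.
suff : z t = 0 by move/eqP; rewrite subr_eq0 => /eqP.
(* Both terms of [z] are [K]-Lipschitz, and [K * T] bounds the displacement over one period. *)
apply: (@dissipation_eq0 R n z (2 * K) (K * T) (alpha - V / eta)).
- by rewrite subr_gt0.
- move=> u v uv; rewrite /z.
  have -> : x0 (v + T) - x0 v - (x0 (u + T) - x0 u) =
      (x0 (v + T) - x0 (u + T)) - (x0 v - x0 u).
    by apply/rowP => i; rewrite !mxE; ring.
  apply: le_trans (enormB _ _) _.
  have := lip _ _ uv; have := lip (u + T) (v + T); rewrite lerD2r => /(_ uv).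
  lra.
- move=> s; have := lip s (s + T); rewrite -/(z s) addrAC subrr add0r.
  by apply; rewrite lerDl ltW.
- have := ae_shift T sol; apply: filterS2 sol => s.
  move=> [dx [v [Nv vV xv]]] [dy [w [Nw wV yw]]].
  have dy' := derivable_shift dy.
  split; first exact: derivableB.
  have -> : derive1 z s = derive1 x0 (s + T) - derive1 x0 s.
    by rewrite -derive1_shift; exact: derive1B.
  move: yw; rewrite (perf _ s) => yw; move: Nw; rewrite (perC s) => Nw.
  (* By periodicity both points lie in the same set [C s], with normals [v] at [x0 s] and [w] at
     [x0 (s + T)]. *)
  have Cy : C s (x0 (s + T)) by rewrite -perC.
  have := prox_regular_dot eta0 (prC s) Nv Cy.
  have := prox_regular_dot eta0 (prC s) Nw (Cx s).
  rewrite enorm_distC -/(z s) -opprB -/(z s) dotNr.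
  have := fmono s (x0 (s + T)) (x0 s); rewrite -/(z s).
  have -> : derive1 x0 (s + T) - derive1 x0 s =
      (v - w) - (f s (x0 (s + T)) - f s (x0 s)).
    by rewrite -[derive1 x0 (s + T)]opprK yw xv; apply/rowP => i; rewrite !mxE; ring.
  rewrite (dotDl (v - w)) (dotDl v) (dotNl (_ - _)) (dotNl w).
  (* Each normal contributes half of [V / eta]; together they give the hypomonotonicity constant,
     which the monotonicity constant [alpha] of [f] exceeds. *)
  have halve (y : R) : y <= V ->
      y / (2 * eta) * enorm (z s) ^+ 2 <= V / eta / 2 * enorm (z s) ^+ 2.
    move=> yV; rewrite ler_wpM2r ?exprn_ge0 ?enorm_ge0// invfM mulrA mulrAC.
    by rewrite ler_wpM2r ?invr_ge0// ler_wpM2r ?invr_ge0 ?(ltW eta0).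
  have := halve _ vV; have := halve _ wV; lra.
Qed.
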